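(* Let $\lambda$ be a non-zero real number and let $r$ be a positive integer. For every integer $n\ge 0$, $$H_{n,\lambda}(x)=\frac{1}{2^{r}}\sum_{k=0}^{n}\binom{n}{k}2^{k}\Bigg[\sum_{j=0}^{r}\binom{r}{j}H_{n-k,\lambda}(j)\Bigg]\mathcal{E}_{k,\lambda}^{(r)}(x),$$ where $H_{n,\lambda}(x)$ are the degenerate Hermite polynomials and $\mathcal{E}_{k,\lambda}^{(r)}(x)$ are the degenerate Euler polynomials of order $r$.
   Context: Fix a non-zero real number $\lambda$. The degenerate exponential functions are $e_\lambda^x(t)=(1+\lambda t)^{x/\lambda}=\sum_{n\ge 0}(x)_{n,\lambda}\frac{t^n}{n!}$, regarded as formal power series in $t$, where $(x)_{0,\lambda}=1$ and $(x)_{n,\lambda}=x(x-\lambda)\cdots(x-(n-1)\lambda)$ for $n\ge 1$; also $e_\lambda(t)=e_\lambda^1(t)$. The degenerate Hermite polynomials $H_{n,\lambda}(x)$ are defined by $$e_\lambda^{-1}(t^2)\, e_\lambda^{x}(2t)=\sum_{n=0}^\infty H_{n,\lambda}(x)\frac{t^n}{n!}.$$ The degenerate Euler polynomials of order $r$ are defined by $$\bigg(\frac{2}{e_\lambda(t)+1}\bigg)^{r}e_\lambda^x(t)=\sum_{n=0}^\infty \mathcal{E}_{n,\lambda}^{(r)}(x)\frac{t^n}{n!}.$$ *)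

(* Defs.v *)
From HB Require Import structures.
From mathcomp Require Import all_boot all_order all_algebra.
From mathcomp Require Import boolp classical_sets functions reals.

Set Implicit Arguments.
Unset Strict Implicit.
Unset Printing Implicit Defensive.

Import Order.TTheory GRing.Theory Num.Theory.
Local Open Scope ring_scope.

(* The ring K[[t]]: a series is its coefficient sequence, f n being the
   coefficient of t^n.  The alias separates it from nat -> K, whose ring
   structure is the pointwise one. *)
Definition fps (K : Type) : Type := nat -> K.

Section FormalPowerSeries.
Variable K : fieldType.
Implicit Types f g h : fps K.

HB.instance Definition _ := GRing.Zmodule.copy (fps K) (nat -> K).

Lemma fpsP f g : (forall n, f n = g n) -> f = g.
Proof. exact: funext. Qed.

Lemma fps_coefD f g n : (f + g) n = f n + g n.
Proof. by []. Qed.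

Definition fps_one : fps K := fun n => (n == 0)%:R.

Definition fps_mul f g : fps K :=
  fun n => \sum_(i < n.+1) f i * g (n - i)%N.

Fact fps_mulC : commutative fps_mul.
Proof.
move=> f g; apply: fpsP => n; rewrite /fps_mul (reindex_inj rev_ord_inj) /=.
by apply: eq_bigr => i _; rewrite subSS mulrC subKn // -ltnS.
Qed.

Fact fps_mulA : associative fps_mul.
Proof.
move=> f g h; apply: fpsP => n; rewrite [RHS](_ : _ = fps_mul h (fps_mul f g) n);
  last by rewrite fps_mulC.
rewrite /fps_mul.
pose coef3 i j := f i * (g (n - i - j)%N * h j).
transitivity (\sum_(i < n.+1) \sum_(j < n.+1 | (j <= n - i)%N) coef3 i j).
  apply: eq_bigr => /= i _; rewrite [X in _ * X](_ : _ = fps_mul h g (n - i)%N);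
    last by rewrite fps_mulC.
  rewrite /fps_mul big_distrr /= (big_ord_narrow_leq (leq_subr _ _)).
  by apply: eq_bigr => j _; rewrite /coef3 [h _ * _]mulrC.
rewrite (exchange_big_dep predT) //=; apply: eq_bigr => k _.
transitivity (\sum_(i < n.+1 | (i <= n - k)%N) coef3 i k).
  apply: eq_bigl => i; rewrite -ltnS -(ltnS i) -!subSn ?leq_ord //.
  by rewrite -subn_gt0 -(subn_gt0 i) -!subnDA addnC.
rewrite (big_ord_narrow_leq (leq_subr _ _)) big_distrr /=.
by apply: eq_bigr => i _; rewrite /coef3 subnAC mulrA mulrC.
Qed.

Fact fps_mul1 : left_id fps_one fps_mul.
Proof.
move=> f; apply: fpsP => n; rewrite /fps_mul big_ord_recl subn0 mul1r.
by rewrite big1 ?addr0 // => i _; rewrite mul0r.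
Qed.

Fact fps_mulDl : left_distributive fps_mul +%R.
Proof.
move=> f g h; apply: fpsP => n; rewrite fps_coefD /fps_mul -big_split /=.
by apply: eq_bigr => i _; rewrite fps_coefD mulrDl.
Qed.

Fact fps_one_neq0 : fps_one != 0.
Proof.
by apply/eqP => /(congr1 (fun f : fps K => f 0%N)) /eqP; rewrite oner_eq0.
Qed.

HB.instance Definition _ := GRing.Zmodule_isComNzRing.Build (fps K)
  fps_mulA fps_mulC fps_mul1 fps_mulDl fps_one_neq0.

Lemma fps_coef1 n : (1 : fps K) n = (n == 0)%:R.
Proof. by []. Qed.

Lemma fps_coefM f g n : (f * g) n = \sum_(i < n.+1) f i * g (n - i)%N.
Proof. by []. Qed.

Definition fps_unit : {pred fps K} := fun f => f 0%N != 0.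

(* The first n coefficients of 1/f, obtained by solving f g = 1 degree by
   degree. *)
Fixpoint fps_inv_prefix f (n : nat) : seq K :=
  if n is m.+1 then
    let s := fps_inv_prefix f m in
    rcons s ((f 0%N)^-1 * ((m == 0)%:R - \sum_(i < m) s`_i * f (m - i)%N))
  else [::].

Definition fps_inv f : fps K :=
  if f \in fps_unit then fun n => (fps_inv_prefix f n.+1)`_n else f.

Fact size_fps_inv_prefix f n : size (fps_inv_prefix f n) = n.
Proof. by elim: n => //= n IH; rewrite size_rcons IH. Qed.

Fact nth_fps_inv_prefix f n i : (i < n)%N ->
  (fps_inv_prefix f n)`_i = (fps_inv_prefix f i.+1)`_i.
Proof.
elim: n => // n IH; rewrite ltnS leq_eqVlt => /orP[/eqP -> //|lt_in].
by rewrite [LHS]/= nth_rcons size_fps_inv_prefix lt_in IH.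
Qed.

Fact fps_mulVf : {in fps_unit, left_inverse 1 fps_inv *%R}.
Proof.
move=> f uf; apply: fpsP => n; rewrite fps_coefM fps_coef1 big_ord_recr subnn.
rewrite /= /fps_inv uf [X in _ + X * _]/= nth_rcons size_fps_inv_prefix.
rewrite ltnn eqxx mulrAC mulVf // mul1r addrC.
under [X in _ - X]eq_bigr => i _ do rewrite nth_fps_inv_prefix //.
exact: subrK.
Qed.

Fact fps_unitPl f g : g * f = 1 -> fps_unit f.
Proof.
move=> /(congr1 (fun h : fps K => h 0%N)); rewrite fps_coefM fps_coef1.
rewrite big_ord1 /= => gf1; apply/eqP => f0; move: gf1.
by rewrite f0 mulr0 => /eqP; rewrite eq_sym oner_eq0.
Qed.

Fact fps_inv_out : {in [predC fps_unit], fps_inv =1 id}.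
Proof. by move=> f; rewrite inE /fps_inv => /negbTE ->. Qed.

HB.instance Definition _ := GRing.ComNzRing_hasMulInverse.Build (fps K)
  fps_mulVf fps_unitPl fps_inv_out.

(* f(c t^d), meaningful for d > 0 *)
Definition fps_subst (c : K) (d : nat) f : fps K :=
  fun n => if (d %| n)%N then c ^+ (n %/ d) * f (n %/ d)%N else 0.

(* the a_n in f = \sum_n a_n t^n / n! *)
Definition egf_coef f (n : nat) : K := n`!%:R * f n.

End FormalPowerSeries.

Section DegeneratePolynomials.
Variable R : realType.
Implicit Types (lam x : R) (n r : nat).

Definition dfalling lam x n : R := \prod_(i < n) (x - i%:R * lam).

(* e_lam^x(t) = (1 + lam t)^(x / lam), given by its binomial expansion *)
Definition dexp lam x : fps R := fun n => dfalling lam x n / n`!%:R.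

(* H_{n,lam}(x), from e_lam^{-1}(t^2) e_lam^x(2t) *)
Definition dhermite lam n x : R :=
  egf_coef (fps_subst 1 2 (dexp lam (-1)) * fps_subst 2 1 (dexp lam x)) n.

(* E_{n,lam}^{(r)}(x), from (2 / (e_lam(t) + 1))^r e_lam^x(t) *)
Definition deuler lam r n x : R :=
  egf_coef ((2 / (dexp lam 1 + 1)) ^+ r * dexp lam x) n.

End DegeneratePolynomials.

(* Main.v *)
(** Put e^x for the degenerate exponential series. Dividing by (e(2t) + 1)^r and
    multiplying back gives
      2^r e^{-1}(t^2) e^x(2t)
        = [(2 / (e(2t) + 1))^r e^x(2t)] * [e^{-1}(t^2) (e(2t) + 1)^r].
    As e^x e^y = e^(x+y), the binomial theorem makes the last factor the sum of
    the binomial(r, j) e^{-1}(t^2) e^j(2t), and the identity follows by comparing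
    coefficients of t^n / n!. *)

Require Import Defs.
From mathcomp Require Import all_boot all_order all_algebra.
From mathcomp Require Import reals.
From mathcomp Require Import ring.

Import Order.TTheory GRing.Theory Num.Theory.
Local Open Scope ring_scope.

Lemma fps_coefMn (K : fieldType) (f : fps K) (m n : nat) :
  (f *+ m) n = f n *+ m.
Proof. by elim: m => // m IH; rewrite !mulrS fps_coefD IH. Qed.

Lemma fps_coef_sum (K : fieldType) (m : nat) (F : 'I_m -> fps K) (n : nat) :
  (\sum_(i < m) F i) n = \sum_(i < m) F i n.
Proof. exact: (big_morph (fun f : fps K => f n) (fun f g => fps_coefD f g n)). Qed.

Lemma fps_scaleE (K : fieldType) (c : K) (f : fps K) (n : nat) :
  fps_subst c 1 f n = c ^+ n * f n.
Proof. by rewrite /fps_subst dvd1n divn1. Qed.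

Lemma fps_scaleM (K : fieldType) (c : K) (f g : fps K) :
  fps_subst c 1 (f * g) = fps_subst c 1 f * fps_subst c 1 g.
Proof.
apply: fpsP => n; rewrite fps_scaleE !fps_coefM mulr_sumr.
apply: eq_bigr => i _; rewrite !fps_scaleE.
have -> : c ^+ n = c ^+ i * c ^+ (n - i) by rewrite -exprD subnKC // -ltnS.
ring.
Qed.

(** Writing n! = C(n, k) k! (n - k)! makes the Cauchy product a binomial convolution. *)
Lemma egf_coefM (K : numFieldType) (f g : fps K) (n : nat) :
  egf_coef (f * g) n =
  \sum_(k < n.+1) 'C(n, k)%:R * egf_coef f k * egf_coef g (n - k).
Proof.
rewrite /egf_coef fps_coefM mulr_sumr; apply: eq_bigr => k _.
have lekn : (k <= n)%N by rewrite -ltnS.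
rewrite -(bin_fact lekn) !natrM; ring.
Qed.

Section DegenerateExponential.
Variables (R : realType) (lam : R).
Implicit Types x y : R.

(** Coefficient form of the differential equation (1 + lam t) F' = x F for F = [dexp lam x]. *)
Lemma dexp_coefS x (n : nat) :
  n.+1%:R * dexp lam x n.+1 = (x - n%:R * lam) * dexp lam x n.
Proof.
rewrite /dexp /dfalling big_ord_recr /= factS natrM.
have n1 : n.+1%:R != 0 :> R by rewrite pnatr_eq0.
have nf : n`!%:R != 0 :> R by rewrite pnatr_eq0 -lt0n fact_gt0.
by field; rewrite nf nat1r n1.
Qed.

Lemma dexp0 : dexp lam 0 = 1.
Proof.
apply: fpsP => -[|n]; first by rewrite /dexp /dfalling big_ord0 divr1.
by rewrite /dexp /dfalling big_ord_recl /= mul0r subrr !mul0r.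
Qed.

(* Both sides satisfy the recurrence of [dexp_coefS] with parameter x + y:
   in degree n + 1 write n + 1 = i + (n + 1 - i) under the convolution sum. *)
Lemma dexpD x y : dexp lam (x + y) = dexp lam x * dexp lam y.
Proof.
apply: fpsP; elim=> [|n IH].
  by rewrite fps_coefM big_ord1 /dexp /dfalling !big_ord0 divr1 mulr1.
have n1 : n.+1%:R != 0 :> R by rewrite pnatr_eq0.
apply: (mulfI n1); rewrite dexp_coefS IH !fps_coefM !mulr_sumr.
set F := dexp lam x; set G := dexp lam y.
transitivity (\sum_(i < n.+2) (i%:R * F i) * G (n.+1 - i)%N +
              \sum_(i < n.+2) F i * ((n.+1 - i)%:R * G (n.+1 - i)%N)).
  (* The terms with weight 0 drop out; the recurrence then applies to each factor, and (x - i lam) +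
     (y - (n - i) lam) = x + y - n lam. *)
  rewrite [X in _ = X + _]big_ord_recl [X in _ = _ + X]big_ord_recr /=.
  rewrite !mul0r add0r subnn mul0r mulr0 addr0 -big_split /=.
  apply: eq_bigr => i _; have lein : (i <= n)%N by rewrite -ltnS.
  rewrite /bump add1n subSS dexp_coefS subSn // dexp_coefS natrB //.
  by rewrite /F /G; ring.
rewrite -big_split /=; apply: eq_bigr => i _.
have lein : (i <= n.+1)%N by rewrite -ltnS.
by rewrite natrB //; ring.
Qed.

Lemma dexp_nat (j : nat) : dexp lam j%:R = dexp lam 1 ^+ j.
Proof. by elim: j => [|j IH]; rewrite ?dexp0 // exprS -IH -dexpD -mulrS. Qed.

(** The constant term is 2, so the quotient in [deuler] is a genuine one. *)
Lemma dexp1D1_unit : dexp lam 1 + 1 \is a GRing.unit.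
Proof.
change ((dexp lam 1 + 1) 0%N != 0).
rewrite fps_coefD fps_coef1 /dexp /dfalling big_ord0 divr1.
by rewrite -(natrD _ 1 1) pnatr_eq0.
Qed.

Lemma dexp_euler (r : nat) x :
  (2 / (dexp lam 1 + 1)) ^+ r * dexp lam x * (dexp lam 1 + 1) ^+ r =
  dexp lam x *+ 2 ^ r.
Proof.
by rewrite mulrAC -exprMn divrK ?dexp1D1_unit // -natrX mulr_natl.
Qed.

Lemma sum_dhermite_nat (r m : nat) :
  \sum_(j < r.+1) 'C(r, j)%:R * dhermite lam m j%:R =
  egf_coef (fps_subst 1 2 (dexp lam (-1)) *
            fps_subst 2 1 ((dexp lam 1 + 1) ^+ r)) m.
Proof.
have -> : fps_subst 2 1 ((dexp lam 1 + 1) ^+ r) =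
    \sum_(j < r.+1) fps_subst 2 1 (dexp lam j%:R) *+ 'C(r, j).
  (* With 1 as first summand, [exprDn] puts the exponent j on [dexp lam 1]. *)
  rewrite addrC exprDn; apply: fpsP => k.
  rewrite fps_scaleE !fps_coef_sum mulr_sumr; apply: eq_bigr => j _.
  by rewrite expr1n mul1r -dexp_nat !fps_coefMn fps_scaleE mulrnAr.
rewrite mulr_sumr /egf_coef fps_coef_sum mulr_sumr; apply: eq_bigr => j _.
by rewrite mulrnAr fps_coefMn mulrnAr mulr_natl.
Qed.

End DegenerateExponential.

Theorem theorem6 (R : realType) (lam : R) (r : nat) (hlam : lam != 0)
    (hr : (0 < r)%N) (n : nat) (x : R) :
  dhermite lam n x =
    (2 ^+ r)^-1 *
    \sum_(k < n.+1)
      'C(n, k)%:R * 2 ^+ k *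
      (\sum_(j < r.+1) 'C(r, j)%:R * dhermite lam (n - k) j%:R) *
      deuler lam r k x.
Proof.
have r2 : 2 ^+ r != 0 :> R by rewrite expf_neq0 // pnatr_eq0.
apply: (mulfI r2); rewrite mulVKf //.
set A := fps_subst 1 2 (dexp lam (-1)).
set E := (2 / (dexp lam 1 + 1)) ^+ r * dexp lam x.
(* The Euler factor comes first so that [egf_coefM] gives it the index k. *)
transitivity (egf_coef (fps_subst 2 1 E *
                        (A * fps_subst 2 1 ((dexp lam 1 + 1) ^+ r))) n).
  rewrite (mulrCA _ A) -fps_scaleM dexp_euler.
  have -> : fps_subst 2 1 (dexp lam x *+ 2 ^ r) =
            fps_subst 2 1 (dexp lam x) *+ 2 ^ r.
    by apply: fpsP => k; rewrite fps_coefMn !fps_scaleE fps_coefMn mulrnAr.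
  by rewrite mulrnAr /egf_coef fps_coefMn mulrnAr -natrX [LHS]mulr_natl.
rewrite egf_coefM; apply: eq_bigr => k _; rewrite sum_dhermite_nat.
(* The factor 2^k comes from the substitution of 2t in [E]. *)
rewrite /deuler -/E -/A {1}/egf_coef fps_scaleE.
by rewrite [egf_coef E k]/egf_coef; ring.
Qed.
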